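(* There is a universal constant $C\ge 1$ such that the following holds for every $d\ge 1$ and every symmetric array $\{b_{ij}\}_{1\le i,j\le d}$ of nonnegative reals. Let $X$ be the $d\times d$ symmetric random matrix with entries $X_{ij}=b_{ij}g_{ij}$ described in the context, and let $\{b^*_{ij}\}$ be the rearranged matrix described in the context. Then any two of the three quantities $$ \mathbf{E}\Bigg[\max_i\sqrt{\sum_j X_{ij}^2}\Bigg],\qquad \|\mathbf{E} X^2\|^{1/2}+\mathbf{E}\max_{ij}|X_{ij}|,\qquad \max_i\sqrt{\sum_j b_{ij}^2}+\max_{ij}b_{ij}^*\sqrt{\log i} $$ are comparable up to the factor $C$, i.e. each of them is at most $C$ times each of the others.
   Context: $\{b_{ij}\}_{1\le i,j\le d}$ are nonnegative reals with $b_{ij}=b_{ji}$; $\{g_{ij}: i\ge j\}$ are independent standard Gaussian random variables, and $g_{ij}:=g_{ji}$ for $i<j$. $X$ is the $d\times d$ symmetric random matrix with entries $X_{ij}=b_{ij}g_{ij}$. $\|\cdot\|$ is the spectral norm (operator norm on Euclidean space) of a matrix, and $\mathbf{E}X^2$ is the entrywise expectation of the matrix $X^2$. The matrix $\{b^*_{ij}\}$ is obtained by permuting the rows and columns of $\{b_{ij}\}$, i.e. $b^*_{ij}=b_{\pi(i)\pi(j)}$ for a permutation $\pi$ of $\{1,\dots,d\}$, such that $\max_j b^*_{1j}\ge\max_j b^*_{2j}\ge\cdots\ge\max_j b^*_{dj}$. All indices $i,j$ range over $\{1,\dots,d\}$; $\log$ is the natural logarithm. *)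

(* Defs.v *)
From HB Require Import structures.
From mathcomp Require Import all_boot all_order all_algebra all_fingroup.
From mathcomp Require Import all_classical all_reals all_analysis.

Set Implicit Arguments.
Unset Strict Implicit.
Unset Printing Implicit Defensive.

Import Order.TTheory GRing.Theory Num.Theory.
Local Open Scope classical_set_scope.
Local Open Scope ring_scope.

Definition standard_gaussian {disp : measure_display} {T : measurableType disp}
    {R : realType} (P : probability T R) (X : {RV P >-> R}) : Prop :=
  forall A : set R, measurable A -> distribution P X A = normal_prob 0 1 A.

Definition independent_RVs {disp : measure_display} {T : measurableType disp}
    {R : realType} (P : probability T R) (I : finType) (D : {set I})
    (X : I -> {RV P >-> R}) : Prop :=
  forall (J : {set I}) (A : I -> set R),
    J \subset D -> (forall i, measurable (A i)) ->
    P (\bigcap_(i in [set` J]) (X i @^-1` A i)) =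
    (\prod_(i in J) P (X i @^-1` A i))%E.

Definition l2norm {R : realType} {d : nat} (x : 'cV[R]_d) : R :=
  Num.sqrt (\sum_(i < d) x i 0 ^+ 2).

(* The norm carried by matrices in the library is the entrywise maximum, so
   the Euclidean operator norm is defined here. *)
Definition spectral_norm {R : realType} {d : nat} (A : 'M[R]_d) : R :=
  sup [set l2norm (A *m x) | x in [set x : 'cV[R]_d | l2norm x <= 1]].

(* Only used on families of nonnegative reals, for which the default value 0
   is harmless. *)
Definition maxI {R : realType} {d : nat} (F : 'I_d -> R) : R :=
  \big[Num.max/0]_(i < d) F i.

Section random_matrix.
Context {disp : measure_display} {T : measurableType disp} {R : realType}.
Context (P : probability T R) {d : nat}.

Definition gaussian_array (g : 'I_d -> 'I_d -> {RV P >-> R}) : Prop :=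
  [/\ forall i j : 'I_d, (j <= i)%N -> standard_gaussian (g i j),
      independent_RVs [set ij : 'I_d * 'I_d | (ij.2 <= ij.1)%N]%SET
        (fun ij => g ij.1 ij.2)
    & forall (i j : 'I_d) (w : T), (i < j)%N -> g i j w = g j i w].

Definition gaussian_matrix (b : 'M[R]_d) (g : 'I_d -> 'I_d -> {RV P >-> R})
    (w : T) : 'M[R]_d :=
  \matrix_(i, j) (b i j * g i j w).

(* [fine] would send an infinite expectation to 0; the second moments of the
   Gaussian matrices considered are all finite. *)
Definition expectation_mx (Y : T -> 'M[R]_d) : 'M[R]_d :=
  \matrix_(i, j) fine 'E_P[fun w => Y w i j]%E.

Definition expected_max_row_norm (X : T -> 'M[R]_d) : \bar R :=
  'E_P[fun w => maxI (fun i => Num.sqrt (\sum_(j < d) X w i j ^+ 2)%R)]%E.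

Definition norm_plus_expected_max (X : T -> 'M[R]_d) : \bar R :=
  ((Num.sqrt (spectral_norm (expectation_mx (fun w => (X w *m X w)%R))))%:E
   + 'E_P[fun w => maxI (fun i => maxI (fun j => `|X w i j|%R))])%E.

End random_matrix.

Definition permute_mx {R : realType} {d : nat} (b : 'M[R]_d) (s : 'S_d) :
    'M[R]_d :=
  \matrix_(i, j) b (s i) (s j).

Definition rows_sorted {R : realType} {d : nat} (b : 'M[R]_d) : Prop :=
  forall i k : 'I_d, (i <= k)%N ->
    maxI (fun j => b k j) <= maxI (fun j => b i j).

(* The indices of 'I_d start at 0, hence log i becomes ln i.+1. *)
Definition explicit_bound {R : realType} {d : nat} (b bstar : 'M[R]_d) : R :=
  maxI (fun i => Num.sqrt (\sum_(j < d) b i j ^+ 2))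
  + maxI (fun i => maxI (fun j => bstar i j * Num.sqrt (ln (i.+1%:R)))).

Definition comparable_upto {R : realType} (C : R) (x y : \bar R) : Prop :=
  (x <= C%:E * y)%E /\ (y <= C%:E * x)%E.

(* Main.v *)
(* Write sigma for the largest row norm of b and S for the maximum of
   b*_ij sqrt(log i).  The off-diagonal entries of E X^2 vanish, so
   ||E X^2||^{1/2} is a constant times sigma, and the three quantities are
   compared cyclically.

   E max_i |X_i| <= C (sigma + S): by independence within a row,
   E exp(l |X_i|^2) <= exp(2 l |b_i|^2) as long as l b_ij^2 <= 1/4 for all j.
   For the k-th row in the sorted order one may take l of order
   log(k+1) / (sigma + S)^2; the excesses of the |X_i|^2 above a multiple of
   (sigma + S)^2 then have summable expectations.

   S <= C E max_ij |X_ij|: if m = b*_ij, each of the first i rows has an entry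
   of size at least m; these occupy at least i/2 distinct positions up to
   symmetry, and the maximum of i/2 independent Gaussians exceeds sqrt(log i)
   with probability bounded below.

   sigma <= C E max_i |X_i|: pair |X_i| with the unit vector b_i / |b_i| and use
   that the |g_ij| have a common positive mean. *)
From HB Require Import structures.
Require Import Defs.
From mathcomp Require Import all_boot all_order all_algebra all_fingroup.
From mathcomp Require Import all_classical all_reals all_analysis.
From mathcomp Require Import measurable_realfun ring lra.
Import Order.TTheory GRing.Theory Num.Theory.
Import numFieldNormedType.Exports.
Set Implicit Arguments.
Unset Strict Implicit.
Unset Printing Implicit Defensive.
Local Open Scope classical_set_scope.
Local Open Scope ring_scope.

(** * Independence and products *)

Section transfer.
Local Open Scope ereal_scope.
Context d d' (T : measurableType d) (T' : measurableType d') (R : realType).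
Variables (mu : {measure set T -> \bar R}) (nu : {measure set T' -> \bar R}).

Import HBNNSimple.

(** The hypothesis on sets says that the measure with density [W], pushed forward by [Y], is [c]
    times [nu]. It extends to nonnegative functions through simple functions and monotone
    convergence. Two uses follow: [W] a product of independent factors, and [W] the Gaussian
    density. *)
Lemma ge0_integral_transfer (Y : T -> T') (W : T -> R) (c : R)
    (h : T' -> R) :
  measurable_fun [set: T] Y -> measurable_fun [set: T] W ->
  (forall x, (0 <= W x)%R) -> (0 <= c)%R ->
  (forall A, measurable A ->
    \int[mu]_x (\1_A (Y x) * W x)%:E = c%:E * nu A) ->
  measurable_fun [set: T'] h -> (forall y, (0 <= h y)%R) ->
  \int[mu]_x (h (Y x) * W x)%:E = c%:E * \int[nu]_y (h y)%:E.
Proof.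
move=> mY mW W0 c0 muW mh h0.
have mEh : measurable_fun [set: T'] (fun y => (h y)%:E).
  exact/measurable_EFinP.
pose h_ := nnsfun_approx measurableT mEh.
have h_cvg y : (EFin \o h_ ^~ y) @ \oo --> (h y)%:E.
  by apply: cvg_nnsfun_approx => // z _; rewrite lee_fin.
have nd_h y : nondecreasing_seq (h_ ^~ y).
  by move=> m n mn; exact/lefP/nd_nnsfun_approx.
have mhY n : measurable_fun [set: T] (h_ n \o Y).
  by apply: measurableT_comp.
have -> : \int[mu]_x (h (Y x) * W x)%:E =
    limn (fun n => \int[mu]_x (h_ n (Y x) * W x)%:E).
  rewrite -monotone_convergence//.
  - apply: eq_integral => x _; apply/esym/cvg_lim => //.
    under eq_fun do rewrite EFinM; rewrite EFinM.
    by apply: cvgeZr => //; exact: h_cvg.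
  - by move=> n; apply/measurable_EFinP/measurable_funM => //; exact: mhY.
  - by move=> n x _; rewrite lee_fin mulr_ge0.
  - by move=> x _ m n mn; rewrite lee_fin ler_wpM2r// nd_h.
have -> : \int[nu]_y (h y)%:E = limn (fun n => \int[nu]_y (h_ n y)%:E).
  rewrite -monotone_convergence//.
  - by apply: eq_integral => y _; apply/esym/cvg_lim => //; exact: h_cvg.
  - by move=> n; apply/measurable_EFinP.
  - by move=> n y _; rewrite lee_fin.
  - by move=> y _ m n mn; rewrite lee_fin; exact: nd_h.
(* A simple function is the sum over its values [y] of [y] times the indicator of a level set, to
   which the hypothesis on sets applies. *)
have step (f : {nnsfun T' >-> R}) :
    \int[mu]_x (f (Y x) * W x)%:E = c%:E * \int[nu]_y (f y)%:E.
  rewrite integralT_nnsfun sintegralE ge0_mule_fsumr; last first.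
    by move=> y; exact: nnsfun_mulemu_ge0.
  have mpre y : measurable (f @^-1` [set y]) by exact: measurable_funPTI.
  transitivity (\int[mu]_x (\sum_(y \in range f)
      (y * (\1_(f @^-1` [set y]) (Y x) * W x))%:E)).
    apply: eq_integral => x _; rewrite fimfunE fsumEFin//; congr EFin.
    rewrite !fsbig_finite//= mulr_suml.
    by apply: eq_bigr => y _; rewrite mulrA.
  rewrite ge0_integral_fsum//.
  - apply: eq_fsbigr => y; rewrite inE => -[z _ <-].
    under eq_integral do rewrite EFinM.
    rewrite ge0_integralZl ?lee_fin//; first by rewrite muW// muleCA.
    + apply/measurable_EFinP/measurable_funM => //.
      exact: (measurableT_comp (measurable_indic (mpre _)) mY).
    + by move=> x _; rewrite lee_fin mulr_ge0.
  - move=> y; apply/measurable_EFinP/measurable_funM => //.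
    apply/measurable_funM => //.
    exact: (measurableT_comp (measurable_indic (mpre _)) mY).
  - move=> y x _; rewrite mulrA EFinM mule_ge0//; last by rewrite lee_fin.
    exact: (nnfun_muleindic_ge0 f y (Y x)).
under eq_fun do rewrite step.
rewrite limeMl//.
apply: ereal_nondecreasing_is_cvgn => m n mn.
apply: ge0_le_integral => //.
- by move=> y _; rewrite lee_fin.
- exact/measurable_EFinP.
- exact/measurable_EFinP.
- by move=> y _; rewrite lee_fin; exact: nd_h.
Qed.

End transfer.

Section independence.
Context (disp : measure_display) (T : measurableType disp) (R : realType).
Variable P : probability T R.

Lemma prod_indic (I : finType) (J : {set I}) (B : I -> set T) (w : T) :
  \prod_(i in J) \1_(B i) w = \1_(\bigcap_(i in [set` J]) B i) w :> R.
Proof.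
have [wB|wB] := pselect ((\bigcap_(i in [set` J]) B i) w).
  rewrite [RHS]indicE mem_set// big1// => i iJ.
  by rewrite indicE mem_set//; exact: wB.
rewrite [RHS]indicE memNset//; move: wB => /existsNP[i] /not_implyP[iJ wBi].
by rewrite (bigD1 i)//= indicE memNset// mul0r.
Qed.

(* The indicators are replaced by general functions one index at a time:
   [indic_off s h] says that [h i] is still an indicator for [i] outside [s]. *)
Lemma integral_prod_independent (I : finType) (D J : {set I})
    (X : I -> {RV P >-> R}) (f : I -> R -> R) (e : I -> R) :
  independent_RVs D X -> J \subset D ->
  (forall i, measurable_fun [set: R] (f i)) -> (forall i y, 0 <= f i y) ->
  (forall i, (\int[P]_w (f i (X i w))%:E = (e i)%:E)%E) ->
  (\int[P]_w (\prod_(i in J) f i (X i w))%:E = (\prod_(i in J) e i)%:E)%E.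
Proof.
move=> indX JD.
pose indic_off (s : seq I) (h : I -> R -> R) :=
  forall i, i \notin s -> exists2 A : set R, measurable A & h i = \1_A.
suff gen (s : seq I) : forall (h : I -> R -> R) (e : I -> R),
    indic_off s h ->
    (forall i, measurable_fun [set: R] (h i)) -> (forall i y, 0 <= h i y) ->
    (forall i, (\int[P]_w (h i (X i w))%:E = (e i)%:E)%E) ->
    (\int[P]_w (\prod_(i in J) h i (X i w))%:E = (\prod_(i in J) e i)%:E)%E.
  by apply: (gen (enum I)) => i; rewrite mem_enum.
have mX i A : measurable A -> measurable (X i @^-1` A).
  by move=> mA; exact: measurable_funPTI.
elim: s => [h {}e hI _ _ he|k s IHs h {}e hI mh h0 he].
  have /all_sig2[A mA hA] : forall i, {A : set R | measurable A & h i = \1_A}.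
    by move=> i; apply: cid2; exact: hI.
  have eP i : P (X i @^-1` A i) = (e i)%:E.
    have mXA := mX i _ (mA i).
    by rewrite -he hA -[X in P X]setIT -integral_indic.
  transitivity (\int[P]_w (\1_(\bigcap_(i in [set` J]) (X i @^-1` A i)) w)%:E)%E.
    apply: eq_integral => w _; congr EFin; rewrite -prod_indic.
    by apply: eq_bigr => i _; rewrite hA.
  rewrite integral_indic//; last first.
    by apply: fin_bigcap_measurable => // i _; exact: mX.
  rewrite setIT; apply: etrans (indX J A JD mA) _.
  by rewrite -prodEFin; apply: eq_bigr => i _; rewrite -eP.
(* Turning the factor at [k] into the indicator of [A] brings the family within the induction
   hypothesis. As [A] varies, this identifies the image under [X k] of the measure whose density [W]
   is the product of the other factors; [ge0_integral_transfer] then restores [h k]. *)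
pose upd (A : set R) i : R -> R := if i == k then \1_A else h i.
pose pk (A : set R) := fine (P (X k @^-1` A)).
pose eupd (A : set R) i : R := if i == k then pk A else e i.
have updP (A : set R) : measurable A ->
    (\int[P]_w (\prod_(i in J) upd A i (X i w))%:E
      = (\prod_(i in J) eupd A i)%:E)%E.
  move=> mA; apply: IHs.
  - move=> i si; rewrite /upd; case: (eqVneq i k) => [_|ik]; first by exists A.
    by apply: hI; rewrite inE negb_or ik.
  - by move=> i; rewrite /upd; case: ifP => // _; exact: measurable_indic.
  - by move=> i y; rewrite /upd; case: ifP => // _; rewrite indicE.
  - move=> i; rewrite /upd /eupd; case: eqP => [->|_]; last exact: he.
    have mXA := mX k _ mA.
    by rewrite fineK ?fin_num_measure// -[X in P X]setIT -integral_indic.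
(* For [k] outside [J] the product does not contain the factor at [k], so any [A] will do. *)
have [kJ|kJ] := boolP (k \in J); last first.
  have neq i : i \in J -> (i == k) = false.
    by move=> iJ; apply/negbTE; apply: contraNneq kJ => <-.
  have := updP _ measurableT; rewrite (eq_bigr e); last first.
    by move=> i iJ; rewrite /eupd neq.
  move=> <-; apply: eq_integral => w _; congr EFin.
  by apply: eq_bigr => i iJ; rewrite /upd neq.
pose W w := \prod_(i in J | i != k) h i (X i w).
pose c := \prod_(i in J | i != k) e i.
have e0 i : 0 <= e i.
  by rewrite -lee_fin -he; apply: integral_ge0 => w _; rewrite lee_fin.
rewrite (bigD1 k)//= mulrC EFinM -he -(@ge0_integral_distribution _ _ _ _ _ P
  (X k) (fun y => (h k y)%:E)); last 2 first.
  exact/measurable_EFinP.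
  by move=> y; rewrite lee_fin.
rewrite -(@ge0_integral_transfer _ _ _ _ _ P (distribution P (X k)) (X k) W c)//.
- by apply: eq_integral => w _; rewrite (bigD1 k).
- rewrite (_ : W = fun w => \prod_i
      (if (i \in J) && (i != k) then h i (X i w) else 1)); last first.
    by apply/funext => w; rewrite /W big_mkcond.
  apply: measurable_prod => i _; case: (_ && _) => //.
  by apply: measurableT_comp => //; exact: mh.
- by move=> w; apply: prodr_ge0.
- exact: prodr_ge0.
- move=> A mA.
  have : (\prod_(i in J) eupd A i)%:E = (c%:E * distribution P (X k) A)%E.
    rewrite (bigD1 k)//= /eupd eqxx mulrC EFinM fineK ?fin_num_measure//; last exact: mX.
    by congr (_%:E * _)%E; apply: eq_bigr => i /andP[_ /negbTE ->].
  move=> <-; rewrite -updP//; apply: eq_integral => w _; congr EFin.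
  rewrite (bigD1 k)//= /upd eqxx; congr (_ * _).
  by apply: eq_bigr => i /andP[_ /negbTE ->].
Qed.

(** This serves for the rows of a symmetric array, whose entries are read off the lower triangle. *)
Lemma independent_RVs_inj (I I' : finType) (D : {set I}) (h : I' -> I)
    (X : I -> {RV P >-> R}) (Y : I' -> {RV P >-> R}) :
  injective h -> (forall i, h i \in D) -> (forall i w, Y i w = X (h i) w) ->
  independent_RVs D X -> independent_RVs [set: I']%SET Y.
Proof.
move=> hI hD YX indX J A _ mA.
have YXA i (B : set R) : Y i @^-1` B = X (h i) @^-1` B.
  by apply/seteqP; split=> w /=; rewrite YX.
(* The sets are carried along [h]; indices outside its range receive the full set. *)
pose A' p := if [pick j | h j == p] is Some j then A j else setT.
have A'h i : A' (h i) = A i.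
  rewrite /A'; case: pickP => [j /eqP/hI -> //|/(_ i)].
  by rewrite eqxx.
have := indX (h @: J)%SET A'; rewrite big_imset/=; last by move=> x y _ _ /hI.
under [in RHS]eq_bigr do rewrite A'h -YXA.
move=> <-; last first.
- by move=> p; rewrite /A'; case: pickP => // *; exact: measurableT.
- by apply/fintype.subsetP => _ /imsetP[i _ ->].
congr (P _); apply/seteqP; split => w wJ p /=.
  by move=> /imsetP[i iJ ->]; have := wJ i iJ; rewrite /preimage/= YX A'h.
by move=> pJ; have := wJ (h p) (imset_f _ pJ); rewrite /preimage/= YX A'h.
Qed.

End independence.

(** * The standard normal distribution *)

Section standard_normal.
Context {R : realType}.
Local Notation mu := (@lebesgue_measure R).
Local Notation gam := (normal_prob (0 : R) 1).

Lemma normal_pdf01E x :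
  normal_pdf 0 1 x = normal_peak 1 * expR (- (x ^+ 2 / 2)) :> R.
Proof.
rewrite normal_pdfE ?oner_eq0// /normal_fun subr0 expr1n mulNr.
by rewrite -[1 *+ 2]/2%:R.
Qed.

(** The integrand is [s] times the centered normal density of standard deviation
    [s = (1 - 2 a)^(-1/2)], so the integral equals [s]. For [a <= 1/4],
    [s^2 <= 1 + 4 a <= exp (4 a)]. *)
Lemma integral_normal_pdf_exp_sqr (a : R) : 0 <= a <= 4^-1 ->
  (\int[mu]_x (expR (a * x ^+ 2) * normal_pdf 0 1 x)%:E <= (expR (2 * a))%:E)%E.
Proof.
move=> /andP[a0 a4].
have q0 : 0 < 1 - 2 * a by lra.
pose s := (Num.sqrt (1 - 2 * a))^-1.
have s0 : 0 < s by rewrite invr_gt0 sqrtr_gt0.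
have s2 : s ^+ 2 = (1 - 2 * a)^-1 by rewrite exprVn sqr_sqrtr// ltW.
have pk : normal_peak 1 = s * normal_peak s.
  rewrite /normal_peak expr1n mul1r -mulrnAr sqrtrM ?sqr_ge0// sqrtr_sqr.
  by rewrite gtr0_norm// invfM mulVKf// gt_eqF.
under eq_integral => x _.
  rewrite (_ : _ * _ = s * normal_pdf 0 s x); last first.
    rewrite normal_pdf01E normal_pdfE ?gt_eqF// /normal_fun subr0 pk.
    rewrite mulrCA -!mulrA; congr (_ * (_ * _)); rewrite -expRD; congr expR.
    by rewrite -mulr_natr s2; field; rewrite gt_eqF.
  rewrite EFinM; over.
rewrite ge0_integralZl//; last 3 first.
  by apply/measurable_EFinP; exact: measurable_normal_pdf.
  by move=> x _; rewrite lee_fin normal_pdf_ge0.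
  by rewrite lee_fin ltW.
rewrite integral_normal_pdf mule1 lee_fin -ler_sqr ?nnegrE ?expR_ge0 ?(ltW s0)// s2.
rewrite -expRM_natr.
apply: (@le_trans _ _ (1 + 2 * a * 2)); last exact: expR_ge1Dx.
rewrite -[leLHS]mul1r ler_pdivrMr//; nra.
Qed.

(* From [(t + 1) ^ 2 / 2 <= t ^ 2 + 1], the density exceeds
   [tail_cst * exp (- t ^ 2)] on [t, t + 1]. *)
Definition tail_cst : R := normal_peak 1 * expR (-1).

Lemma tail_cst_gt0 : 0 < tail_cst.
Proof. by rewrite mulr_gt0 ?expR_gt0 ?normal_peak_gt0 ?oner_eq0. Qed.

Lemma measurable_normr_ge (t : R) : measurable [set x : R | t <= `|x|].
Proof.
rewrite -[X in measurable X]setTI.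
exact: (measurable_fun_ler (measurable_cst t) (@normr_measurable R setT)).
Qed.

(** The tail contains [[t, t + 1]], of length 1. The bound is tailored to [t = sqrt (ln n)], where
    it equals [tail_cst / n]. *)
Lemma normal_prob_tail (t : R) : 0 <= t ->
  ((tail_cst * expR (- t ^+ 2))%:E <= gam [set x | (t <= `|x|)%R])%E.
Proof.
move=> t0.
have mtail := measurable_normr_ge t.
apply: (@le_trans _ _ (gam `[t, t + 1]%classic)); last first.
  apply: le_measure; rewrite ?inE//.
  by move=> x /=; rewrite in_itv/= => /andP[tx _]; rewrite (le_trans tx)// ler_norm.
rewrite /normal_prob.
apply: (@le_trans _ _
  (\int[mu]_(x in `[t, (t + 1)%R]) (tail_cst * expR (- t ^+ 2))%:E)%E).
  rewrite integral_cst//= lebesgue_measure_itv/= lte_fin ltrDl ltr01.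
  by rewrite -EFinD addrAC subrr add0r mule1.
apply: ge0_le_integral => //.
- by move=> x _; rewrite lee_fin mulr_ge0 ?expR_ge0// ltW// tail_cst_gt0.
- apply/measurable_EFinP/measurable_funTS; exact: measurable_normal_pdf.
- move=> x /=; rewrite in_itv/= => /andP[tx xt].
  rewrite lee_fin normal_pdf01E /tail_cst -mulrA ler_wpM2l ?normal_peak_ge0//.
  rewrite -expRD ler_expR.
  have : x ^+ 2 <= (t + 1) ^+ 2 by rewrite ler_sqr ?nnegrE; lra.
  have := sqr_ge0 (t - 1); rewrite !expr2; lra.
Qed.

(** Both Lebesgue measure and the density are invariant under negation. *)
Lemma integral_normal_pdf_symmetric (h : R -> R) :
  measurable_fun [set: R] h -> (forall x, 0 <= h x) ->
  (\int[mu]_x (h (- x) * normal_pdf 0 1 x)%:E =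
   \int[mu]_x (h x * normal_pdf 0 1 x)%:E)%E.
Proof.
move=> mh h0.
have mhp : measurable_fun [set: R] (fun x => (h x * normal_pdf 0 1 x)%:E).
  by apply/measurable_EFinP/measurable_funM => //; exact: measurable_normal_pdf.
transitivity (\int[pushforward mu (-%R : _ -> measurableTypeR R)]_x
    (h x * normal_pdf 0 1 x)%:E)%E.
  rewrite ge0_integral_pushforward//=.
  - by apply: eq_integral => x _ /=; rewrite !normal_pdf01E sqrrN.
  - by move=> x _; rewrite lee_fin mulr_ge0// normal_pdf_ge0.
apply: eq_measure_integral => A mA _; exact: lebesgue_measureN.
Qed.

(* Transferring along the identity also bridges the two measurable structures
   carried by the reals: the one of [lebesgue_measure] and the default one. *)
Lemma standard_gaussian_integral (disp : measure_display)
    (T : measurableType disp) (P : probability T R) (X : {RV P >-> R})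
    (h : R -> R) :
  standard_gaussian X -> measurable_fun [set: R] h -> (forall x, 0 <= h x) ->
  (\int[P]_w (h (X w))%:E = \int[mu]_x (h x * normal_pdf 0 1 x)%:E)%E.
Proof.
move=> gX mh h0.
transitivity (\int[distribution P X]_x (h x)%:E)%E.
  rewrite ge0_integral_distribution//; exact/measurable_EFinP.
rewrite -[LHS]mul1e.
rewrite -(@ge0_integral_transfer _ _ _ _ _ mu (distribution P X)
  (id : measurableTypeR R -> R) (normal_pdf 0 1) 1)//.
- exact: measurable_normal_pdf.
- exact: normal_pdf_ge0.
- move=> A mA; rewrite mul1e; apply: etrans (esym (gX A mA)).
  rewrite /normal_prob [RHS]integral_mkcond.
  apply: eq_integral => x _; rewrite patchE indicE.
  by case: ifPn => _; rewrite ?mul1r ?mul0r.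
Qed.

End standard_normal.

(** * Moments of Gaussian variables *)

Section gaussian_moments.
Context {R : realType}.
Local Notation mu := (@lebesgue_measure R).

(* Meaningful when the integral is finite; [fine] sends an infinite one to 0. *)
Definition gauss_mean (h : R -> R) : R :=
  fine (\int[mu]_x (h x * normal_pdf 0 1 x)%:E)%E.

Lemma measurable_funM_normal_pdf (h : R -> R) : measurable_fun [set: R] h ->
  measurable_fun [set: measurableTypeR R]
    (fun x => (h x * normal_pdf 0 1 x)%:E).
Proof.
move=> mh; apply/measurable_EFinP/measurable_funM => //.
exact: measurable_normal_pdf.
Qed.

(** The dominating function uses the largest rate, [1/4], for which the integral of [exp (a x^2)]
    has been bounded; it covers all test functions used below. *)
Lemma gauss_mean_fin (c : R) (h : R -> R) : measurable_fun [set: R] h ->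
  (forall x, 0 <= h x <= c * expR (4^-1 * x ^+ 2)) ->
  (\int[mu]_x (h x * normal_pdf 0 1 x)%:E)%E \is a fin_num.
Proof.
move=> mh hc; have h0 x : 0 <= h x by case/andP: (hc x).
have c0 : 0 <= c.
  by have /andP[/le_trans /[apply]] := hc 0; rewrite expr0n/= mulr0 expR0 mulr1.
have mexp : measurable_fun [set: R] (fun x => expR (4^-1 * x ^+ 2)).
  by apply: measurableT_comp => //; apply: measurable_funM.
rewrite ge0_fin_numE; last first.
  by apply: integral_ge0 => x _; rewrite lee_fin mulr_ge0// normal_pdf_ge0.
apply: (@le_lt_trans _ _ (c%:E *
    \int[mu]_x (expR (4^-1 * x ^+ 2) * normal_pdf 0 1 x)%:E)%E).
  rewrite -ge0_integralZl ?lee_fin//.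
  - apply: ge0_le_integral => //.
    + by move=> x _; rewrite lee_fin mulr_ge0// normal_pdf_ge0.
    + exact: measurable_funM_normal_pdf.
    + by apply: measurable_funeM; exact: measurable_funM_normal_pdf.
    + move=> x _; rewrite -EFinM lee_fin mulrA ler_wpM2r ?normal_pdf_ge0//.
      by case/andP: (hc x).
  - exact: measurable_funM_normal_pdf.
  - by move=> x _; rewrite lee_fin mulr_ge0 ?expR_ge0// normal_pdf_ge0.
have /(integral_normal_pdf_exp_sqr) E : 0 <= (4^-1 : R) <= 4^-1 by lra.
apply: le_lt_trans (ltry (c * expR (2 / 4))).
by rewrite EFinM lee_wpmul2l// lee_fin.
Qed.

(** The mean is at least the probability that [|x| >= 1], which is positive by the tail bound. *)
Lemma gauss_mean_gt0 (c : R) (h : R -> R) : measurable_fun [set: R] h ->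
  (forall x, 0 <= h x <= c * expR (4^-1 * x ^+ 2)) ->
  (forall x, 1 <= `|x| -> 1 <= h x) -> 0 < gauss_mean h.
Proof.
move=> mh hc h1; have h0 x : 0 <= h x by case/andP: (hc x).
have tail := @normal_prob_tail R 1 ler01.
rewrite -lte_fin /gauss_mean fineK; last exact: (gauss_mean_fin mh hc).
apply: lt_le_trans (le_trans tail _).
  by rewrite lte_fin mulr_gt0 ?expR_gt0// tail_cst_gt0.
rewrite /normal_prob integral_mkcond; apply: ge0_le_integral => //.
- by move=> x _; rewrite patchE; case: ifP => // _; rewrite lee_fin normal_pdf_ge0.
- apply/(measurable_restrictT _ _).1; first exact: measurable_normr_ge.
  by apply/measurable_EFinP/measurable_funTS; exact: measurable_normal_pdf.
- exact: measurable_funM_normal_pdf.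
- move=> x _; rewrite patchE; case: ifPn => [|_]; last first.
    by rewrite lee_fin mulr_ge0// normal_pdf_ge0.
  rewrite inE/= => /h1 hx; rewrite lee_fin -[leLHS]mul1r ler_wpM2r//.
  exact: normal_pdf_ge0.
Qed.

Lemma sqr_le_expR (x : R) : 0 <= x ^+ 2 <= 4 * expR (4^-1 * x ^+ 2).
Proof.
by rewrite sqr_ge0/=; have := expR_ge1Dx (4^-1 * x ^+ 2); lra.
Qed.

Lemma normr_le_expR (x : R) : 0 <= `|x| <= 1 * expR (4^-1 * x ^+ 2).
Proof.
rewrite normr_ge0/= mul1r; have := expR_ge1Dx (4^-1 * x ^+ 2).
apply: le_trans; rewrite -(real_normK (num_real x)).
by have := sqr_ge0 (`|x| - 2); rewrite !expr2; lra.
Qed.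

Lemma measurable_pos : measurable_fun [set: R] (fun x => Num.max x 0).
Proof. exact: measurable_maxr. Qed.

Lemma measurable_neg : measurable_fun [set: R] (fun x => Num.max (- x) 0).
Proof. by apply: measurable_maxr => //; exact: measurable_funN. Qed.

Lemma pos_le_expR (x : R) : 0 <= Num.max x 0 <= 1 * expR (4^-1 * x ^+ 2).
Proof.
rewrite le_max lexx orbT/=; case/andP: (normr_le_expR x) => _.
by apply: le_trans; rewrite ge_max ler_norm normr_ge0.
Qed.

Lemma neg_le_expR (x : R) : 0 <= Num.max (- x) 0 <= 1 * expR (4^-1 * x ^+ 2).
Proof. by rewrite -sqrrN; exact: pos_le_expR. Qed.

(** A signed product thus reduces to products of nonnegative functions, for which independence
    factors the integral. *)
Lemma pos_mul (x y : R) :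
  Num.max (x * y) 0 =
    Num.max x 0 * Num.max y 0 + Num.max (- x) 0 * Num.max (- y) 0.
Proof.
have [x0|/ltW x0] := lerP x 0; have [y0|/ltW y0] := lerP y 0.
- rewrite !max_l ?oppr_ge0//; first by rewrite mul0r add0r mulrNN.
  exact: mulr_le0.
- rewrite max_r ?mulr_le0_ge0// mul0r add0r.
  by rewrite (@max_r _ _ (- y)) ?mulr0// oppr_le0.
- rewrite max_r ?mulr_ge0_le0// mulr0 add0r.
  by rewrite (@max_r _ _ (- x)) ?mul0r// oppr_le0.
- rewrite (@max_r _ _ (- x)) ?mul0r ?addr0; last by rewrite oppr_le0.
  by rewrite max_l// mulr_ge0.
Qed.

Lemma gauss_mean_neg :
  gauss_mean (fun x => Num.max (- x) 0) = gauss_mean (fun x => Num.max x 0).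
Proof.
congr fine; apply: (@integral_normal_pdf_symmetric _ (fun x => Num.max x 0)).
  exact: measurable_pos.
by move=> x; case/andP: (pos_le_expR x).
Qed.

Context (disp : measure_display) (T : measurableType disp).
Variable P : probability T R.

Lemma standard_gaussian_mean (c : R) (h : R -> R) (X : {RV P >-> R}) :
  standard_gaussian X -> measurable_fun [set: R] h ->
  (forall x, 0 <= h x <= c * expR (4^-1 * x ^+ 2)) ->
  (\int[P]_w (h (X w))%:E = (gauss_mean h)%:E)%E.
Proof.
move=> gX mh hc; rewrite fineK; last exact: (gauss_mean_fin mh hc).
by apply: standard_gaussian_integral => // x; case/andP: (hc x).
Qed.

Lemma standard_gaussian_exp_sqr (a : R) (X : {RV P >-> R}) :
  standard_gaussian X -> 0 <= a <= 4^-1 ->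
  exists2 e : R, 0 <= e <= expR (2 * a) &
    (\int[P]_w (expR (a * X w ^+ 2))%:E = e%:E)%E.
Proof.
move=> gX /[dup] a4 /andP[a0 a1]; pose h x := expR (a * x ^+ 2).
have mh : measurable_fun [set: R] h.
  by apply: measurableT_comp => //; apply: measurable_funM.
have hc x : 0 <= h x <= 1 * expR (4^-1 * x ^+ 2).
  by rewrite expR_ge0/= mul1r ler_expR ler_wpM2r// sqr_ge0.
exists (gauss_mean h); last exact: (standard_gaussian_mean gX mh hc).
rewrite -!lee_fin fineK; last exact: (gauss_mean_fin mh hc).
rewrite integral_normal_pdf_exp_sqr// andbT; apply: integral_ge0 => x _.
by rewrite lee_fin mulr_ge0 ?expR_ge0// normal_pdf_ge0.
Qed.

Lemma standard_gaussian_tail (t : R) (X : {RV P >-> R}) :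
  standard_gaussian X -> 0 <= t ->
  ((tail_cst * expR (- t ^+ 2))%:E <= P [set w | t <= `|X w|]%R)%E.
Proof.
move=> gX t0; apply: le_trans (normal_prob_tail t0) _.
by rewrite -(gX _ (measurable_normr_ge t)).
Qed.

Lemma independent_gaussian_mean_mul (I : finType) (X : I -> {RV P >-> R})
    (f h : R -> R) (c : R) (i k : I) :
  (forall j, standard_gaussian (X j)) -> independent_RVs [set: I]%SET X ->
  i != k -> measurable_fun [set: R] f -> measurable_fun [set: R] h ->
  (forall x, 0 <= f x <= c * expR (4^-1 * x ^+ 2)) ->
  (forall x, 0 <= h x <= c * expR (4^-1 * x ^+ 2)) ->
  (\int[P]_w (f (X i w) * h (X k w))%:E
    = (gauss_mean f * gauss_mean h)%:E)%E.
Proof.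
move=> gX indX ik mf mh fc hc.
pose F j := if j == i then f else h.
have ki : (k == i) = false by rewrite eq_sym; apply/negbTE.
have set2 (u : I -> R) : (\prod_(j in [set i; k]%SET) u j = u i * u k)%R.
  by rewrite big_setU1 ?inE//= big_set1.
have Fi : F i = f by rewrite /F eqxx.
have Fk : F k = h by rewrite /F ki.
have := @integral_prod_independent _ _ _ P I [set: I]%SET [set i; k]%SET X F
  (fun j => gauss_mean (F j)) indX.
rewrite set2 Fi Fk => <-.
- by apply: eq_integral => w _; rewrite set2 Fi Fk.
- exact: finset.subsetT.
- by move=> j; rewrite /F; case: ifP.
- by move=> j y; rewrite /F; case: ifP => _; [case/andP: (fc y)|case/andP: (hc y)].
- move=> j; apply: (@standard_gaussian_mean c) => //; rewrite /F; by case: ifP.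
Qed.

(** Splitting both variables into positive and negative parts gives four products. By independence
    and symmetry all have the same finite mean, and two of them enter with each sign. *)
Lemma independent_gaussian_uncorrelated (I : finType)
    (X : I -> {RV P >-> R}) (i k : I) :
  (forall j, standard_gaussian (X j)) -> independent_RVs [set: I]%SET X ->
  i != k ->
  P.-integrable [set: T] (fun w => (X i w * X k w)%:E) /\
  (\int[P]_w (X i w * X k w)%:E = 0)%E.
Proof.
move=> gX indX ik.
have mXX : measurable_fun [set: T] (fun w => (X i w * X k w)%:E).
  by apply/measurable_EFinP/measurable_funM.
have mean f h := independent_gaussian_mean_mul gX indX ik (f := f) (h := h) (c := 1).
split.
  apply/integrableP; split => //.
  under eq_integral do rewrite abse_EFin normrM.
  have mn : measurable_fun [set: R] (fun x : R => `|x|) by exact: normr_measurable.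
  rewrite (mean (fun x => `|x|) (fun x => `|x|)) ?ltry//.
  - exact: normr_le_expR.
  - exact: normr_le_expR.
have mpos (l m : R -> R) : measurable_fun [set: R] l ->
    measurable_fun [set: R] m ->
    measurable_fun [set: T] (fun w => (l (X i w) * m (X k w))%:E).
  move=> ml mm; apply/measurable_EFinP/measurable_funM.
    exact: (measurableT_comp ml).
  exact: (measurableT_comp mm).
pose pp (x : R) : R := Num.max x 0; pose nn (x : R) : R := Num.max (- x) 0.
have pp0 x : 0 <= pp x by case/andP: (pos_le_expR x).
have nn0 x : 0 <= nn x by case/andP: (neg_le_expR x).
have mpp : measurable_fun [set: R] pp := measurable_pos.
have mnn : measurable_fun [set: R] nn := measurable_neg.
have nnE : gauss_mean nn = gauss_mean pp by exact: gauss_mean_neg.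
have ppP := pos_le_expR; have nnP := neg_le_expR.
have two (l m l' m' : R -> R) : measurable_fun [set: R] l ->
    measurable_fun [set: R] m -> measurable_fun [set: R] l' ->
    measurable_fun [set: R] m' -> (forall x, 0 <= l x) ->
    (forall x, 0 <= m x) -> (forall x, 0 <= l' x) -> (forall x, 0 <= m' x) ->
    (\int[P]_w (l (X i w) * m (X k w) + l' (X i w) * m' (X k w))%:E =
     \int[P]_w (l (X i w) * m (X k w))%:E
      + \int[P]_w (l' (X i w) * m' (X k w))%:E)%E.
  move=> ml mm ml' mm' l0 m0 l0' m0'; under eq_integral do rewrite EFinD.
  rewrite ge0_integralD//.
  - by move=> w _; rewrite lee_fin mulr_ge0.
  - exact: mpos.
  - by move=> w _; rewrite lee_fin mulr_ge0.
  - exact: mpos.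
rewrite integralE.
under eq_integral => w _ do rewrite funeposE -EFin_max pos_mul.
(* The negative part of [x * y] is the positive part of [x * - y]. *)
under [X in (_ - X)%E]eq_integral => w _.
  rewrite funenegE (_ : maxe _ (0 : \bar R) = (Num.max (X i w * - X k w) 0)%:E); last first.
    by rewrite mulrN EFin_max.
  rewrite pos_mul opprK; over.
rewrite (two pp pp nn nn)// (two pp nn nn pp)//.
rewrite (mean pp pp)// (mean nn nn)// (mean pp nn)// (mean nn pp)// nnE.
by rewrite subee.
Qed.

End gaussian_moments.

(** * Norms of matrices *)

Section maxima.
Context {R : realType} {d : nat}.
Implicit Types (F : 'I_d -> R).

Lemma maxI_ge F i : F i <= maxI F.
Proof. by rewrite /maxI le_bigmax. Qed.

Lemma maxI_ge0 F : 0 <= maxI F.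
Proof. by rewrite /maxI bigmax_idl le_max lexx. Qed.

Lemma maxI_le F x : 0 <= x -> (forall i, F i <= x) -> maxI F <= x.
Proof. by move=> x0 Fx; apply/bigmax_leP. Qed.

Lemma measurable_maxI (disp : measure_display) (T : measurableType disp)
    (F : T -> 'I_d -> R) :
  (forall i, measurable_fun [set: T] (F ^~ i)) ->
  measurable_fun [set: T] (fun w => maxI (F w)).
Proof.
move=> mF; rewrite /maxI; elim: (index_enum _) => [|i r IHr].
  by under eq_fun do rewrite big_nil; exact: measurable_cst.
by under eq_fun do rewrite big_cons; exact: measurable_maxr.
Qed.

Lemma spectral_norm_diag (A : 'M[R]_d) (r : 'I_d -> R) :
  (forall i, 0 <= r i) -> (forall i k, A i k = if i == k then r i else 0) ->
  spectral_norm A = maxI r.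
Proof.
move=> r0 Ar.
have Ax (x : 'cV[R]_d) i : (A *m x) i 0 = r i * x i 0.
  rewrite mxE (bigD1 i)//= Ar eqxx big1 ?addr0// => k ki.
  by rewrite Ar eq_sym (negbTE ki) mul0r.
have M0 := maxI_ge0 r.
have Axr : ubound [set l2norm (A *m x) | x in [set x : 'cV[R]_d | l2norm x <= 1]]
    (maxI r).
  move=> _ [x /= x1 <-]; apply: (@le_trans _ _ (maxI r * l2norm x)); last first.
    by rewrite ler_piMr.
  rewrite -[in leRHS](ger0_norm M0) -sqrtr_sqr -sqrtrM ?sqr_ge0//.
  rewrite ler_wsqrtr// mulr_sumr ler_sum// => i _.
  rewrite Ax exprMn ler_wpM2r ?sqr_ge0//.
  by rewrite ler_sqr ?nnegrE ?maxI_ge.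
apply/eqP; rewrite eq_le; apply/andP; split.
  apply: ge_sup => //; exists (l2norm (A *m 0)); exists 0 => //=.
  rewrite /l2norm big1 ?sqrtr0// => i _.
  by rewrite mxE expr0n.
have nz0 : l2norm (0 : 'cV[R]_d) = 0.
  by rewrite /l2norm big1 ?sqrtr0// => i _; rewrite mxE expr0n.
(* As [maxI] starts from 0, the supremum must also be shown nonnegative; the zero vector does
   this. *)
apply: maxI_le => [|i].
  apply: ub_le_sup; first by exists (maxI r).
  by exists 0; rewrite /= ?mulmx0 nz0.
apply: ub_le_sup; first by exists (maxI r).
have l2e (x : 'cV[R]_d) (c : R) : 0 <= c ->
    (forall k, x k 0 = if k == i then c else 0) -> l2norm x = c.
  move=> c0 xE; rewrite /l2norm (bigD1 i)//= xE eqxx big1 ?addr0.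
    by rewrite sqrtr_sqr ger0_norm.
  by move=> k /negbTE ki; rewrite xE ki expr0n.
(* The [i]-th basis vector is scaled by exactly [r i]. *)
exists (\col_k (k == i)%:R) => /=.
  by rewrite (l2e _ 1)// => k; rewrite mxE; case: eqP.
by apply: l2e => // k; rewrite Ax mxE; case: eqP => [->|_]; rewrite ?mulr1 ?mulr0.
Qed.

(** With [p] and [q] the two norms, weighted AM-GM bounds each term by
    [q / (2 p) * a^2 + p / (2 q) * x^2], and these bounds sum to [p q]. If a norm vanishes, so does
    its vector. *)
Lemma cauchy_schwarz (a x : 'I_d -> R) :
  \sum_j a j * x j <= Num.sqrt (\sum_j a j ^+ 2) * Num.sqrt (\sum_j x j ^+ 2).
Proof.
have s0 (u : 'I_d -> R) : 0 <= \sum_j u j ^+ 2.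
  by apply: sumr_ge0 => j _; exact: sqr_ge0.
have z0 (u : 'I_d -> R) j : Num.sqrt (\sum_j u j ^+ 2) = 0 -> u j = 0.
  move/eqP; rewrite sqrtr_eq0 => us; apply/eqP; rewrite -sqrf_eq0.
  rewrite eq_le sqr_ge0 andbT; apply: le_trans us.
  by rewrite (bigD1 j)//= lerDl; apply: sumr_ge0 => k _; exact: sqr_ge0.
set p := Num.sqrt (\sum_j a j ^+ 2); set q := Num.sqrt (\sum_j x j ^+ 2).
have p2 : p ^+ 2 = \sum_j a j ^+ 2 by rewrite sqr_sqrtr.
have q2 : q ^+ 2 = \sum_j x j ^+ 2 by rewrite sqr_sqrtr.
have [p_eq0|p_neq0] := eqVneq p 0.
  by rewrite p_eq0 mul0r big1// => j _; rewrite (z0 a) ?mul0r.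
have [q_eq0|q_neq0] := eqVneq q 0.
  by rewrite q_eq0 mulr0 big1// => j _; rewrite (z0 x) ?mulr0.
have p0 : 0 < p by rewrite lt_neqAle eq_sym p_neq0 sqrtr_ge0.
have q0 : 0 < q by rewrite lt_neqAle eq_sym q_neq0 sqrtr_ge0.
apply: (@le_trans _ _ (\sum_j (q / (2 * p) * a j ^+ 2 + p / (2 * q) * x j ^+ 2))).
  apply: ler_sum => j _; rewrite -subr_ge0.
  have -> : q / (2 * p) * a j ^+ 2 + p / (2 * q) * x j ^+ 2 - a j * x j =
      (q * a j - p * x j) ^+ 2 / (2 * p * q) by field; rewrite p_neq0 q_neq0.
  by rewrite divr_ge0 ?sqr_ge0// !mulr_ge0 ?ltW.
rewrite big_split/= -!mulr_sumr -p2 -q2.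
by rewrite le_eqVlt; apply/orP; left; apply/eqP; field; rewrite p_neq0 q_neq0.
Qed.

End maxima.

(** * Gaussian matrices *)

Section gaussian_matrix.
Context {disp : measure_display} {T : measurableType disp} {R : realType}.
Context (P : probability T R) {d : nat}.
Variables (b : 'M[R]_d) (g : 'I_d -> 'I_d -> {RV P >-> R}).
Hypothesis b0 : forall i j, 0 <= b i j.
Hypothesis bsym : forall i j, b i j = b j i.
Hypothesis gP : gaussian_array g.
Let X := gaussian_matrix b g.

Lemma ge0_expectation_le (f h : T -> R) :
  measurable_fun [set: T] f -> measurable_fun [set: T] h ->
  (forall w, 0 <= f w) -> (forall w, f w <= h w) -> ('E_P[f] <= 'E_P[h])%E.
Proof.
move=> mf mh f0 fh; apply: expectation_le => //; last exact: aeW.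
by move=> w; apply: le_trans (fh w).
Qed.

Lemma gaussian_array_sym i j w : g i j w = g j i w.
Proof.
case: gP => _ _ gsym; case: (ltngtP i j) => ij; first exact: gsym.
  exact/esym/gsym.
by have -> : i = j by exact: val_inj.
Qed.

Lemma gaussian_array_standard i j : standard_gaussian (g i j).
Proof.
case: gP => gG _ _; have [ij|ji] := leqP j i; first exact: gG.
move=> A mA; rewrite -(gG j i (ltnW ji) A mA); congr (P _).
by apply/seteqP; split => w /=; rewrite gaussian_array_sym.
Qed.

(** The representative of an unordered position in the lower triangle, where independence is
    assumed. *)
Definition lower_pair (i j : 'I_d) : 'I_d * 'I_d :=
  if (j <= i)%N then (i, j) else (j, i).

Lemma lower_pair_le i j : ((lower_pair i j).2 <= (lower_pair i j).1)%N.
Proof. by rewrite /lower_pair; case: ifPn => [//|]; rewrite -ltnNge => /ltnW. Qed.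

Lemma gaussian_array_lower i j w :
  g i j w = g (lower_pair i j).1 (lower_pair i j).2 w.
Proof. by rewrite /lower_pair; case: ifP => //=; rewrite gaussian_array_sym. Qed.

(** For fixed [i], [lower_pair i] is injective: the entries of one row sit at distinct positions of
    the lower triangle. *)
Lemma gaussian_array_row_independent i : independent_RVs [set: 'I_d]%SET (g i).
Proof.
case: gP => _ gI _; apply: (independent_RVs_inj (h := lower_pair i) _ _ _ gI).
- move=> j k; rewrite /lower_pair.
  by case: ifP => _; case: ifP => _ [] //= -> ->.
- by move=> j; rewrite inE lower_pair_le.
- by move=> j w; rewrite gaussian_array_lower.
Qed.

Let gsq := gauss_mean (fun x : R => x ^+ 2).
Let gabs := gauss_mean (fun x : R => `|x|).

(** These are the products occurring in entry [(i, k)] of the squared matrix. By symmetry both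
    factors lie in row [j], so independence within a row suffices. *)
Lemma gaussian_array_product i j k :
  P.-integrable [set: T] (fun w => (g i j w * g j k w)%:E) /\
  (\int[P]_w (g i j w * g j k w)%:E = (if i == k then gsq else 0)%:E)%E.
Proof.
have gE : (fun w => (g i j w * g j k w)%:E) = (fun w => (g j i w * g j k w)%:E).
  by apply/funext => w; rewrite gaussian_array_sym.
rewrite gE; have [<-{k gE}|ik] := eqVneq i k; last first.
  apply: independent_gaussian_uncorrelated => //.
    by move=> k'; exact: gaussian_array_standard.
  exact: gaussian_array_row_independent.
have msq : measurable_fun [set: R] (fun x : R => x ^+ 2) by exact: measurable_funX.
have intE := standard_gaussian_mean (gaussian_array_standard j i) msq sqr_le_expR.
have -> : (fun w => (g j i w * g j i w)%:E) = (fun w => (g j i w ^+ 2)%:E).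
  by apply/funext => w; rewrite expr2.
split => //; apply/integrableP; split.
  by apply/measurable_EFinP; exact: measurable_funX.
under eq_integral do rewrite abse_EFin ger0_norm ?sqr_ge0//.
by rewrite intE ltry.
Qed.

Lemma expectation_mx_sqr i k :
  expectation_mx P (fun w => X w *m X w) i k =
    if i == k then gsq * \sum_j b i j ^+ 2 else 0.
Proof.
have intg j c : P.-integrable [set: T] (fun w => (c%:E * (g i j w * g j k w)%:E)%E).
  by apply: integrableZl => //; case: (gaussian_array_product i j k).
rewrite mxE unlock.
transitivity (fine (\int[P]_w
    (\sum_j ((b i j * b j k)%:E * (g i j w * g j k w)%:E)))%E).
  congr fine; apply: eq_integral => w _.
  rewrite mxE -sumEFin; apply: eq_bigr => j _; rewrite !mxE -EFinM; congr EFin.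
  ring.
rewrite integral_sum//.
under eq_bigr => j _.
  case: (gaussian_array_product i j k) => intj gj.
  rewrite integralZl// gj -EFinM; over.
rewrite sumEFin/=; case: eqP => [<-|_]; last by rewrite big1// => j _; rewrite mulr0.
by rewrite mulr_sumr; apply: eq_bigr => j _; rewrite (bsym j i) expr2; ring.
Qed.

Let sigma := maxI (fun i => Num.sqrt (\sum_j b i j ^+ 2)).

Lemma sum_sqr_ge0 (I : finType) (u : I -> R) : 0 <= \sum_j u j ^+ 2.
Proof. by apply: sumr_ge0 => j _; exact: sqr_ge0. Qed.

(** For a diagonal matrix the norm is a maximum, and the square root, being monotone, passes through
    it. *)
Lemma sqrt_spectral_norm_expectation_mx_sqr :
  Num.sqrt (spectral_norm (expectation_mx P (fun w => X w *m X w))) =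
    Num.sqrt gsq * sigma.
Proof.
have gsq0 : 0 <= gsq.
  apply/ltW/(gauss_mean_gt0 _ sqr_le_expR); first exact: measurable_funX.
  by move=> x x1; rewrite -real_normK ?num_real// expr_ge1.
rewrite (spectral_norm_diag (r := fun i => gsq * \sum_j b i j ^+ 2)).
- apply/eqP; rewrite eq_le; apply/andP; split.
    rewrite -[leRHS]ger0_norm ?mulr_ge0 ?sqrtr_ge0 ?maxI_ge0// -sqrtr_sqr.
    rewrite ler_wsqrtr//; apply: maxI_le => [|i]; first exact: sqr_ge0.
    rewrite exprMn sqr_sqrtr// ler_wpM2l//.
    rewrite -[leLHS]sqr_sqrtr ?sum_sqr_ge0// ler_sqr ?nnegrE ?maxI_ge0//.
    exact: (maxI_ge (fun i => Num.sqrt (\sum_j b i j ^+ 2))).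
  have [gsq_eq0|gsq_neq0] := eqVneq gsq 0.
    by rewrite gsq_eq0 sqrtr0 mul0r sqrtr_ge0.
  have sgsq : 0 < Num.sqrt gsq by rewrite sqrtr_gt0 lt_neqAle eq_sym gsq_neq0.
  rewrite -ler_pdivlMl//; apply: maxI_le => [|i].
    by rewrite mulr_ge0 ?invr_ge0// sqrtr_ge0.
  rewrite ler_pdivlMl// -sqrtrM// ler_wsqrtr//.
  exact: (maxI_ge (fun i => gsq * \sum_j b i j ^+ 2)).
- by move=> i; rewrite mulr_ge0// sum_sqr_ge0.
- exact: expectation_mx_sqr.
Qed.

Lemma measurable_gaussian_matrix i j : measurable_fun [set: T] (fun w => X w i j).
Proof.
rewrite (_ : (fun w => _) = fun w => b i j * g i j w).
  exact: measurable_funM.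
by apply/funext => w; rewrite mxE.
Qed.

Lemma measurable_row_norm i :
  measurable_fun [set: T] (fun w => Num.sqrt (\sum_j X w i j ^+ 2)).
Proof.
apply: (@measurableT_comp _ _ _ _ _ _ (@Num.sqrt R)).
  by apply: continuous_measurable_fun; exact: sqrt_continuous.
by apply: measurable_sum => j; apply: measurable_funX; exact: measurable_gaussian_matrix.
Qed.

Lemma measurable_max_row_norm :
  measurable_fun [set: T] (fun w => maxI (fun i => Num.sqrt (\sum_j X w i j ^+ 2))).
Proof. by apply: measurable_maxI => i; exact: measurable_row_norm. Qed.

Lemma measurable_max_entry :
  measurable_fun [set: T] (fun w => maxI (fun i => maxI (fun j => `|X w i j|))).
Proof.
apply: measurable_maxI => i; apply: measurable_maxI => j.
by apply: measurableT_comp => //; exact: measurable_gaussian_matrix.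
Qed.

Lemma expected_max_entry_le :
  ('E_P[fun w => maxI (fun i => maxI (fun j => `|X w i j|%R))]
    <= expected_max_row_norm P X)%E.
Proof.
apply: ge0_expectation_le.
- exact: measurable_max_entry.
- exact: measurable_max_row_norm.
- by move=> w; exact: maxI_ge0.
- move=> w; apply: maxI_le => [|i]; first exact: maxI_ge0.
  apply: maxI_le => [|j]; first exact: maxI_ge0.
  apply: le_trans (maxI_ge _ i).
  rewrite -sqrtr_sqr ler_wsqrtr// (bigD1 j)//= lerDl.
  by apply: sumr_ge0 => k _; exact: sqr_ge0.
Qed.

Lemma row_norm_le_expectation i :
  ((gabs * Num.sqrt (\sum_j b i j ^+ 2))%:E <= expected_max_row_norm P X)%E.
Proof.
set s := Num.sqrt _.
have E0 : (0 <= expected_max_row_norm P X)%E.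
  by apply: expectation_ge0 => w; exact: maxI_ge0.
have [s_eq0|s_neq0] := eqVneq s 0; first by rewrite s_eq0 mulr0.
have s0 : 0 < s by rewrite lt_neqAle eq_sym s_neq0 sqrtr_ge0.
have s2 : s ^+ 2 = \sum_j b i j ^+ 2 by rewrite sqr_sqrtr// sum_sqr_ge0.
have absE j := standard_gaussian_mean (gaussian_array_standard i j)
  (@normr_measurable R setT) (@normr_le_expR R).
have mg j : measurable_fun [set: T] (fun w => `|g i j w|).
  by apply: measurableT_comp => //.
(* [Z] pairs the absolute values of row [i] of [X] with the unit vector [b i / s]; its mean is
   [gabs * s] because the squares of the [b i j] sum to [s^2]. *)
pose Z w := \sum_j b i j ^+ 2 / s * `|g i j w|.
have <- : ('E_P[Z] = (gabs * s)%:E)%E.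
  rewrite unlock /Z; under eq_integral do rewrite -sumEFin.
  rewrite ge0_integral_sum//.
  - transitivity (\sum_j (b i j ^+ 2 / s * gabs)%:E)%E.
      apply: eq_bigr => j _; under eq_integral do rewrite EFinM.
      rewrite ge0_integralZl//.
      + by rewrite absE.
      + exact/measurable_EFinP.
      + by rewrite lee_fin divr_ge0 ?sqr_ge0// ltW.
    by rewrite sumEFin -mulr_suml -mulr_suml -s2 mulrC expr2 mulfK.
  - move=> j; apply/measurable_EFinP; exact: measurable_funM.
  - by move=> j w _; rewrite lee_fin mulr_ge0// divr_ge0 ?sqr_ge0// ltW.
apply: ge0_expectation_le.
- by apply: measurable_sum => j; exact: measurable_funM.
- exact: measurable_max_row_norm.
- move=> w; apply: sumr_ge0 => j _.
  by rewrite mulr_ge0// divr_ge0 ?sqr_ge0// ltW.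
- move=> w; apply: le_trans (maxI_ge _ i).
  (* After multiplication by [s], the left side is the sum of [b i j * |X w i j|], ready for
     Cauchy-Schwarz. *)
  rewrite -(ler_pM2l s0).
  have := cauchy_schwarz (b i) (fun j => `|X w i j|); rewrite -/s.
  under [X in _ * Num.sqrt X]eq_bigr do rewrite real_normK ?num_real//.
  apply: le_trans; rewrite le_eqVlt; apply/orP; left; apply/eqP.
  rewrite /Z mulr_sumr; apply: eq_bigr => j _.
  by rewrite mxE normrM (ger0_norm (b0 i j)) mulrA mulrCA divff// mulr1 expr2 mulrA.
Qed.

End gaussian_matrix.

(** * Lower bound on the expected largest entry *)

Section lower_bound.
Context {disp : measure_display} {T : measurableType disp} {R : realType}.
Context (P : probability T R) {d : nat}.
Variables (b : 'M[R]_d) (s : 'S_d) (g : 'I_d -> 'I_d -> {RV P >-> R}).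
Hypothesis b0 : forall i j, 0 <= b i j.
Hypothesis bsorted : rows_sorted (permute_mx b s).
Hypothesis gP : gaussian_array g.
Let X := gaussian_matrix b g.

(** Positivity of [x] rules out the default value 0 of [maxI]. *)
Lemma maxI_attained (F : 'I_d -> R) x : 0 < x -> x <= maxI F ->
  exists j, x <= F j.
Proof.
move=> x0 xF; apply: contrapT => /forallNP Fx.
suff : maxI F < x by rewrite ltNge xF.
by apply/bigmax_ltP; split => // j _; rewrite ltNge; apply/negP/Fx.
Qed.

(* An unordered pair comes from at most its two elements. *)
Lemma card_lower_pair_image (K : {set 'I_d}) (h : 'I_d -> 'I_d) :
  (#|K| <= 2 * #|[set lower_pair k (h k) | k in K]%SET|)%N.
Proof.
set J := [set lower_pair k (h k) | k in K]%SET.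
have KJ : (K \subset [set p.1 | p in J] :|: [set p.2 | p in J])%SET.
  apply/fintype.subsetP => k kK; have kJ : lower_pair k (h k) \in J by exact: imset_f.
  rewrite inE; apply/orP; move: kJ; rewrite /lower_pair.
  case: ifP => _ kJ; [left|right]; apply/imsetP.
    by exists (k, h k).
  by exists (h k, k).
apply: leq_trans (subset_leq_card KJ) _.
rewrite (leq_trans (leq_card_setU _ _))// mul2n -addnn.
by apply: leq_add; exact: leq_imset_card.
Qed.

(** By independence the probability is a product of factors at most [1 - q <= exp (- q)], where [q]
    is the tail bound at [t]. *)
Lemma gaussian_array_small_prob (J : {set 'I_d * 'I_d}) (t : R) :
  (forall p, p \in J -> (p.2 <= p.1)%N) -> 0 <= t ->
  (P (\bigcap_(p in [set` J]) [set w | `|g p.1 p.2 w| < t]%R)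
    <= (expR (- (tail_cst * expR (- t ^+ 2)) * #|J|%:R))%:E)%E.
Proof.
move=> Jlow t0; case: (gP) => gG gI _.
have mB : measurable [set x : R | `|x| < t].
  rewrite (_ : [set x : R | `|x| < t] = ~` [set x : R | t <= `|x|]).
    by apply: measurableC; exact: measurable_normr_ge.
  by apply/seteqP; split=> x /=; rewrite ltNge => /negP.
have JD : (J \subset [set ij : 'I_d * 'I_d | (ij.2 <= ij.1)%N])%SET.
  by apply/fintype.subsetP => p pJ; rewrite inE Jlow.
have := gI J (fun=> [set x : R | `|x| < t]) JD (fun=> mB).
rewrite /preimage/= => ->.
pose pr p := fine (P [set w | `|g p.1 p.2 w| < t]).
have mA i j : measurable [set w | `|g i j w| < t].
  by rewrite (_ : [set w | _] = g i j @^-1` [set x : R | `|x| < t])//;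
    exact: measurable_funPTI.
have prE p : P [set w | `|g p.1 p.2 w| < t] = (pr p)%:E.
  by rewrite fineK// fin_num_measure.
under eq_bigr do rewrite prE.
rewrite prodEFin lee_fin expRM_natr -prodr_const.
apply: ler_prod => p pJ; apply/andP; split.
  by rewrite -lee_fin -prE measure_ge0.
apply: le_trans (expR_ge1Dx _).
have := standard_gaussian_tail (gaussian_array_standard gP p.1 p.2) t0.
rewrite (_ : [set w | _] = ~` [set w | `|g p.1 p.2 w| < t]); last first.
  by apply/seteqP; split=> w /=; rewrite leNgt => /negP.
rewrite probability_setC// prE -EFinB lee_fin; lra.
Qed.

Lemma expected_max_entry_ge (i j : 'I_d) :
  (((1 - expR (- (tail_cst / 2)))
      * (permute_mx b s i j * Num.sqrt (ln i.+1%:R)))%:E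
    <= 'E_P[fun w => maxI (fun i => maxI (fun j => `|X w i j|%R))])%E.
Proof.
set t := Num.sqrt _; set m := permute_mx b s i j.
have m0 : 0 <= m by rewrite /m mxE.
have [m_eq0|m_neq0] := eqVneq m 0.
  rewrite m_eq0 mul0r mulr0; apply: expectation_ge0 => w; exact: maxI_ge0.
have {m0 m_neq0} m0 : 0 < m by rewrite lt_neqAle eq_sym m_neq0.
have t0 : 0 <= t by exact: sqrtr_ge0.
(* By sortedness, each of the first rows has an entry of size at least [m]; for the later rows the
   column is a dummy value. *)
have large (k : 'I_d) : exists l, (k <= i)%N -> m <= b (s k) l.
  have [ki|ki] := leqP k i; last by exists k.
  have /(maxI_attained m0)[l ml] : m <= maxI (fun l => permute_mx b s k l).
    by apply: le_trans (bsorted ki); exact: (maxI_ge (fun l => permute_mx b s i l)).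
  by exists (s l) => _; move: ml; rewrite mxE.
have [f fP] := choice large.
(* The original indices of the first [i.+1] rows in sorted order. *)
pose K := [set s k | k : 'I_d in [pred k : 'I_d | (k <= i)%N]]%SET.
pose h k := f ((s^-1)%g k).
have hP k : k \in K -> m <= b k (h k).
  by move=> /imsetP[l li ->]; rewrite /h permK; exact: fP.
have cardK : #|K| = i.+1.
  rewrite card_imset; last exact: perm_inj.
  rewrite -sum1_card (eq_bigl (fun k : 'I_d => (k < i.+1)%N))//.
  by rewrite -(big_ord_widen _ (fun=> 1%N))// sum1_card card_ord.
pose J := [set lower_pair k (h k) | k in K]%SET.
have cardJ : (i.+1 <= 2 * #|J|)%N by rewrite -cardK; exact: card_lower_pair_image.
pose A := \bigcap_(p in [set` J]) [set w | `|g p.1 p.2 w| < t].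
have mA : measurable A.
  apply: fin_bigcap_measurable => // p _.
  rewrite (_ : [set w | _] = g p.1 p.2 @^-1` (~` [set x : R | t <= `|x|])).
    by apply: measurable_funPTI => //; apply: measurableC; exact: measurable_normr_ge.
  by apply/seteqP; split=> w /=; rewrite ltNge => /negP.
have PA : (P A <= (expR (- (tail_cst / 2)))%:E)%E.
  apply: le_trans (gaussian_array_small_prob _ t0) _.
    by move=> _ /imsetP[k _ ->]; exact: lower_pair_le.
  (* Here [exp (- t^2) = 1 / (i + 1)], while [J] has at least [(i + 1) / 2] elements, so the
     exponent is at most [- tail_cst / 2]. *)
  rewrite lee_fin ler_expR mulNr lerN2.
  have i1 : (1 : R) <= i.+1%:R by rewrite ler1n.
  have i0 : 0 < i.+1%:R :> R by rewrite ltr0n.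
  rewrite sqr_sqrtr ?ln_ge0// expRN lnK ?posrE// -[leRHS]mulrA.
  rewrite ler_pM2l ?tail_cst_gt0// ler_pdivlMl// ler_pdivrMr//.
  by rewrite -natrM ler_nat mulnC.
have mt0 : 0 <= m * t by rewrite mulr_ge0// ltW.
have mI : measurable_fun [set: T] (\1_(~` A) : T -> R).
  by apply: measurable_indic; exact: measurableC.
have mEI := (measurable_EFinP _ _).2 mI.
(* Markov's inequality in disguise: off [A], some selected Gaussian reaches [t], so an entry of [X]
   reaches [m * t]. *)
pose Y (w : T) : R := m * t * \1_(~` A) w.
apply: (@le_trans _ _ ('E_P[Y])%E).
  rewrite unlock /Y; under eq_integral do rewrite EFinM.
  rewrite ge0_integralZl//.
  rewrite integral_indic//; last exact: measurableC.
  have PAC : (P (~` A) = 1 - P A)%E by exact: probability_setC.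
  rewrite setIT mulrC EFinM; apply: lee_wpmul2l; first by rewrite lee_fin.
  apply: le_trans (_ : 1 - P A <= _)%E; first by rewrite EFinB leeB.
  by rewrite le_eqVlt -PAC eqxx.
apply: ge0_expectation_le.
- exact: measurable_funM.
- exact: measurable_max_entry.
- by move=> w; rewrite /Y mulr_ge0// indicE.
- move=> w; rewrite /Y indicE; have [|_] := boolP (w \in ~` A); last first.
    by rewrite mulr0 maxI_ge0.
  rewrite inE => /existsNP[p] /not_implyP[/imsetP[k kK pE]].
  move=> /negP; rewrite -leNgt pE -gaussian_array_lower// mulr1 => tg.
  apply: le_trans (maxI_ge _ k); apply: le_trans (maxI_ge _ (h k)).
  rewrite mxE normrM ger0_norm//; apply: ler_pM => //; first exact: ltW.
  exact: hP.
Qed.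

End lower_bound.

(** * Upper bound on the expected largest row norm *)

Section upper_bound.
Context {disp : measure_display} {T : measurableType disp} {R : realType}.
Context (P : probability T R) {d : nat}.
Variables (b : 'M[R]_d) (s : 'S_d) (g : 'I_d -> 'I_d -> {RV P >-> R}).
Hypothesis gP : gaussian_array g.
Let X := gaussian_matrix b g.

(** The exponential of the sum factors over the independent entries of the row, and each factor
    falls under the bound for [exp (a g^2)] with [a = l * b i j ^+ 2]. *)
Lemma row_exp_sqr (i : 'I_d) (l : R) : 0 <= l ->
  (forall j, l * b i j ^+ 2 <= 4^-1) ->
  (\int[P]_w (expR (l * \sum_j X w i j ^+ 2))%:E
    <= (expR (2 * l * \sum_j b i j ^+ 2))%:E)%E.
Proof.
move=> l0 lb; pose a j := l * b i j ^+ 2.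
have a4 j : 0 <= a j <= 4^-1 by rewrite mulr_ge0 ?sqr_ge0//=; exact: lb.
have /choice[e eP] : forall j, exists e : R, 0 <= e <= expR (2 * a j) /\
    (\int[P]_w (expR (a j * g i j w ^+ 2))%:E = e%:E)%E.
  move=> j; have [e] := standard_gaussian_exp_sqr (gaussian_array_standard gP i j) (a4 j).
  by exists e.
have eint : (\int[P]_w (\prod_(j in [set: 'I_d]%SET) expR (a j * g i j w ^+ 2))%:E
    = (\prod_(j in [set: 'I_d]%SET) e j)%:E)%E.
  apply: (integral_prod_independent (f := fun j x => expR (a j * x ^+ 2))
    (gaussian_array_row_independent gP i)) => //.
  - move=> j; apply: measurableT_comp => //; apply: measurable_funM => //.
  - by move=> j; case: (eP j).
under eq_integral => w _.
  rewrite (_ : expR _ = \prod_(j in [set: 'I_d]%SET) expR (a j * g i j w ^+ 2)).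
    over.
  rewrite -expR_sum; congr expR; rewrite mulr_sumr; apply: eq_big => [j|j _].
    by rewrite inE.
  by rewrite mxE exprMn mulrA.
rewrite eint lee_fin (eq_bigl xpredT) => [|j]; last by rewrite inE.
rewrite (mulrC 2) -mulrA !mulr_sumr expR_sum.
apply: ler_prod => j _; case: (eP j) => /andP[e0 ea] _.
by rewrite e0/=; apply: le_trans ea _; rewrite ler_expR /a mulrCA.
Qed.

(** Telescoping with [1 / (k + 2)^2 <= 1 / (k + 1) - 1 / (k + 2)]; the induction needs the sharper
    bound [1 - 1 / (n + 1)]. *)
Lemma sum_inv_sqr (n : nat) : \sum_(k < n) (k.+2%:R ^+ 2)^-1 <= 1 :> R.
Proof.
suff : \sum_(k < n) (k.+2%:R ^+ 2)^-1 <= 1 - n.+1%:R^-1 :> R.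
  by move/le_trans; apply; rewrite gerBl invr_ge0.
elim: n => [|n IHn]; first by rewrite big_ord0 invr1 subrr.
rewrite big_ord_recr/=; apply: le_trans (lerD IHn (lexx _)) _.
have n0 : 0 <= n%:R :> R by [].
rewrite -[n.+2]addn2 -[n.+1]addn1 !natrD.
move: (n%:R) n0 => x x0.
have x1 : x + 1 != 0 by rewrite gt_eqF//; lra.
have x2 : x + 2 != 0 by rewrite gt_eqF//; lra.
rewrite -subr_ge0 (_ : _ - _ = ((x + 1) * (x + 2) ^+ 2)^-1).
  by rewrite invr_ge0 mulr_ge0 ?sqr_ge0//; lra.
by field; rewrite x1 x2.
Qed.

(** AM-GM for [K] and [y / K]. It reduces the mean of a row norm to that of its square. *)
Lemma sqrt_le_amgm (K y : R) : 0 < K -> 0 <= y -> Num.sqrt y <= (K + y / K) / 2.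
Proof.
move=> K0 y0; rewrite ler_pdivlMr// -(ler_pM2r K0) mulrDl divfK ?gt_eqF//.
rewrite -[X in _ <= _ + X](sqr_sqrtr y0).
by have := sqr_ge0 (Num.sqrt y - K); rewrite !expr2; lra.
Qed.

Lemma half_le_ln (k : nat) : 2^-1 <= ln k.+2%:R :> R.
Proof.
apply: (@le_trans _ _ (ln 2)); last by rewrite ler_ln ?posrE ?ltr0n// ler_nat.
rewrite -ler_expR lnK ?posrE// -[X in expR X]opprK expRN.
by rewrite invf_ple ?posrE ?expR_gt0//; apply: le_trans (expR_ge1Dx _); lra.
Qed.

(* With [Y k] the squared norm of the k-th row in the sorted order,
   [Y k <= 18 K^2 + exp (l k (Y k - 18 K^2)) / l k], where the rate [l k] is
   chosen so that the exponential has mean at most [(k + 2)^-2]. *)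
Lemma expected_max_row_norm_le (K : R) : 0 < K ->
  (forall i, \sum_j b i j ^+ 2 <= K ^+ 2) ->
  (forall k j, permute_mx b s k j ^+ 2 * ln k.+2%:R <= 2 * K ^+ 2) ->
  (expected_max_row_norm P X <= (18 * K)%:E)%E.
Proof.
move=> K0 rowK entryK.
have K2 : 0 < K ^+ 2 by rewrite exprn_gt0.
(* The factor 8 turns the hypothesis [entryK] into [l k * b^2 <= 1/4], the condition of
   [row_exp_sqr]. *)
pose l (k : 'I_d) := ln k.+2%:R / (8 * K ^+ 2).
have l16 k : (16 * K ^+ 2)^-1 <= l k.
  rewrite /l ler_pdivlMr ?mulr_gt0//; apply: le_trans (half_le_ln k).
  by rewrite le_eqVlt; apply/orP; left; apply/eqP; field; rewrite gt_eqF.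
have l0 k : 0 < l k by apply: lt_le_trans (l16 k); rewrite invr_gt0 mulr_gt0.
pose Y k w := \sum_j X w (s k) j ^+ 2.
pose Z k w := expR (l k * (Y k w - 18 * K ^+ 2)).
have mY k : measurable_fun [set: T] (Y k).
  by apply: measurable_sum => j; apply: measurable_funX; exact: measurable_gaussian_matrix.
have mZ k : measurable_fun [set: T] (Z k).
  by apply: measurableT_comp => //; apply: measurable_funM => //; exact: measurable_funB.
have EZ k : (\int[P]_w (Z k w)%:E <= ((k.+2%:R ^+ 2)^-1)%:E)%E.
  pose u := expR (- (l k * (18 * K ^+ 2))).
  have u0 : 0 <= u by exact: expR_ge0.
  under eq_integral => w _ do rewrite /Z mulrBr addrC expRD EFinM -/u.
  have mE : measurable_fun [set: T] (fun w => (expR (l k * Y k w))%:E).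
    apply/measurable_EFinP; apply: measurableT_comp => //.
    exact: measurable_funM.
  rewrite ge0_integralZl//.
  have lb j : l k * b (s k) j ^+ 2 <= 4^-1.
    rewrite /l mulrAC ler_pdivrMr ?mulr_gt0//.
    have := entryK k ((s^-1)%g j); rewrite mxE permKV mulrC; lra.
  apply: le_trans (lee_wpmul2l _ (row_exp_sqr (ltW (l0 k)) lb)) _.
    by rewrite lee_fin.
  (* The constant 18 is [2 + 16]: 2 cancels the exponent from [row_exp_sqr], and
     [16 * K^2 * l k = 2 * ln (k + 2)] yields the factor [(k + 2)^-2]. *)
  rewrite -EFinM lee_fin -expRD.
  have -> : (k.+2%:R ^+ 2)^-1 = expR (- (2 * ln k.+2%:R)) :> R.
    by rewrite expRN mulrC expRM_natr lnK// posrE ltr0n.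
  rewrite ler_expR.
  have -> : ln k.+2%:R = l k * (8 * K ^+ 2) :> R.
    by rewrite divfK// gt_eqF// mulr_gt0.
  have := ler_wpM2l (ltW (l0 k)) (rowK (s k)); lra.
(* Inserting [Y k <= 18 K^2 + 16 K^2 Z k] into [(K + Y k / K) / 2] gives [f], once [Z k] is replaced
   by the sum of all of them. The mean of [f] is then at most [(19/2 + 8) K]. *)
pose f w := 19 / 2 * K + 8 * K * \sum_k Z k w.
have mf : measurable_fun [set: T] f.
  apply: measurable_funD => //; apply: measurable_funM => //.
  exact: measurable_sum.
have SZ0 w : 0 <= \sum_k Z k w by apply: sumr_ge0 => k _; exact: expR_ge0.
apply: (@le_trans _ _ ('E_P[f])%E).
  apply: ge0_expectation_le => //.
  - exact: measurable_max_row_norm.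
  - by move=> w; exact: maxI_ge0.
  - move=> w; apply: maxI_le => [|i].
      by rewrite addr_ge0// mulr_ge0// ltW// mulr_gt0// divr_gt0.
    pose k := (s^-1)%g i; have -> : i = s k by rewrite permKV.
    have y0 : 0 <= Y k w by exact: sum_sqr_ge0.
    apply: le_trans (sqrt_le_amgm K0 y0) _.
    have Zk : Z k w <= \sum_k Z k w.
      by rewrite (bigD1 k)//= lerDl; apply: sumr_ge0 => k' _; exact: expR_ge0.
    (* Above the threshold, this is [x <= exp x] at [x = l k * (Y k w - 18 K^2)], combined with the
       lower bound [l16] on the rate. *)
    have YZ : Y k w <= 18 * K ^+ 2 + 16 * K ^+ 2 * Z k w.
      have Z0 : 0 <= Z k w by exact: expR_ge0.
      have [yK|/ltW yK] := lerP (Y k w) (18 * K ^+ 2).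
        by apply: le_trans yK _; rewrite lerDl mulr_ge0// mulr_ge0// ltW.
      rewrite -lerBlDl -ler_pdivrMl ?mulr_gt0//.
      apply: (@le_trans _ _ (l k * (Y k w - 18 * K ^+ 2))).
        by rewrite ler_wpM2r// subr_ge0.
      have := expR_ge1Dx (l k * (Y k w - 18 * K ^+ 2)).
      by apply: le_trans; rewrite lerDr.
    have YK : Y k w / K <= 18 * K + 16 * K * \sum_k Z k w.
      rewrite ler_pdivrMr//; apply: le_trans YZ _.
      have := ler_wpM2l (ltW K2) Zk; rewrite expr2; lra.
    rewrite /f; lra.
rewrite unlock; under eq_integral => w _ do
  rewrite /f EFinD (EFinM (8 * K)) -sumEFin.
have mEZ k : measurable_fun [set: T] (fun w => (Z k w)%:E) by exact/measurable_EFinP.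
have K8 : 0 <= 8 * K by rewrite mulr_ge0// ltW.
have mS : measurable_fun [set: T] (fun w => \sum_k (Z k w)%:E)%E.
  exact: emeasurable_sum.
have ES0 w : (0 <= \sum_k (Z k w)%:E)%E by rewrite sumEFin lee_fin.
rewrite ge0_integralD//; first last.
- exact: measurable_funeM.
- by move=> w _; rewrite mule_ge0.
- by move=> w _; rewrite lee_fin mulr_ge0// ltW.
rewrite integral_cst//= probability_setT mule1 ge0_integralZl//.
rewrite ge0_integral_sum//; last by move=> k w _; rewrite lee_fin expR_ge0.
apply: (@le_trans _ _ ((19 / 2 * K)%:E + (8 * K)%:E * (1%:E))%E).
  rewrite leeD2l//; apply: lee_wpmul2l; first by rewrite lee_fin.
  apply: (@le_trans _ _ (\sum_(k < d) ((k.+2%:R ^+ 2)^-1)%:E)%E).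
    by apply: lee_sum => k _; exact: EZ.
  by rewrite sumEFin lee_fin sum_inv_sqr.
by rewrite mule1 -EFinD lee_fin; lra.
Qed.

End upper_bound.

(** * Comparison of the three quantities *)

(** The exponential rates use [ln (k + 2)], positive even for the first row, whereas the explicit
    bound has [ln (k + 1)]. For [k > 0], [k + 2 <= (k + 1)^2] makes them comparable; for [k = 0] the
    entry is bounded by its row norm and [ln 2 <= 2]. *)
Lemma explicit_bound_entry (R : realType) (d : nat) (b : 'M[R]_d) (s : 'S_d)
    (k j : 'I_d) : (forall i j, 0 <= b i j) ->
  permute_mx b s k j ^+ 2 * ln k.+2%:R <=
    2 * explicit_bound b (permute_mx b s) ^+ 2.
Proof.
move=> b0; set B := permute_mx b s; set K := explicit_bound b B.
have B0 : 0 <= B k j by rewrite mxE.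
have BK : B k j <= K.
  apply: (@le_trans _ _ (maxI (fun i => Num.sqrt (\sum_j b i j ^+ 2)))); last first.
    by rewrite lerDl maxI_ge0.
  apply: le_trans (maxI_ge _ (s k)).
  rewrite -(ger0_norm B0) -sqrtr_sqr ler_wsqrtr// (bigD1 (s j))//= mxE lerDl.
  by apply: sumr_ge0 => l _; exact: sqr_ge0.
have K2 : B k j ^+ 2 <= K ^+ 2 by rewrite ler_sqr ?nnegrE// (le_trans B0).
have [k0|k0] := posnP k.
  have ln2 : ln k.+2%:R <= 2 :> R.
    by rewrite k0 (le_trans (ltW (ln_sublinear _)))// ltr0n.
  by rewrite mulrC ler_pM// ?sqr_ge0// ln_ge0// ler1n.
have BS : B k j * Num.sqrt (ln k.+1%:R) <= K.
  apply: (@le_trans _ _ (maxI (fun i : 'I_d => maxI (fun j =>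
      B i j * Num.sqrt (ln i.+1%:R))))); last by rewrite lerDr maxI_ge0.
  apply: le_trans (maxI_ge _ k).
  exact: (maxI_ge (fun j => B k j * Num.sqrt (ln k.+1%:R))).
have : (B k j * Num.sqrt (ln k.+1%:R)) ^+ 2 <= K ^+ 2.
  by rewrite ler_sqr ?nnegrE ?mulr_ge0 ?sqrtr_ge0// (le_trans B0).
rewrite exprMn sqr_sqrtr ?ln_ge0 ?ler1n// => BS2.
have ln2 : ln k.+2%:R <= 2 * ln k.+1%:R :> R.
  rewrite mulrC -[2]/(2%:R) mulr_natr -lnXn ?ltr0n// ler_ln ?posrE ?exprn_gt0 ?ltr0n//.
  by rewrite -natrX ler_nat expnS expn1 mulSn -[k.+2]addn1 leq_add2l muln_gt0 k0.
have := ler_wpM2l (sqr_ge0 (B k j)) ln2; lra.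
Qed.

Theorem theorem1p2 (R : realType) :
  exists2 C : R, 1 <= C &
    forall (d : nat) (b : 'M[R]_d) (s : 'S_d)
      (disp : measure_display) (T : measurableType disp) (P : probability T R)
      (g : 'I_d -> 'I_d -> {RV P >-> R}),
    (0 < d)%N ->
    (forall i j, 0 <= b i j) ->
    (forall i j, b i j = b j i) ->
    rows_sorted (permute_mx b s) ->
    gaussian_array g ->
    let X := gaussian_matrix b g in
    let Q1 := expected_max_row_norm P X in
    let Q2 := norm_plus_expected_max P X in
    let Q3 := (explicit_bound b (permute_mx b s))%:E in
    [/\ comparable_upto C Q1 Q2,
        comparable_upto C Q1 Q3
      & comparable_upto C Q2 Q3].
Proof.
pose gsq : R := gauss_mean (fun x => x ^+ 2).
pose gabs : R := gauss_mean (fun x => `|x|).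
have gsq0 : 0 < gsq.
  apply: (gauss_mean_gt0 _ sqr_le_expR); first exact: measurable_funX.
  by move=> x x1; rewrite -real_normK ?num_real// expr_ge1.
have gabs0 : 0 < gabs.
  by apply: (gauss_mean_gt0 _ normr_le_expR) => //; exact: normr_measurable.
have sgsq0 : 0 < Num.sqrt gsq by rewrite sqrtr_gt0.
pose c : R := 1 - expR (- (tail_cst / 2)).
have c0 : 0 < c.
  by rewrite subr_gt0 -expR0 ltr_expR oppr_lt0 divr_gt0// tail_cst_gt0.
(* [C2] bounds the third quantity by the second: [(Num.sqrt gsq)^-1] pays for [sigma] and [c^-1] for
   [S]. [C3] bounds the second by the first, using that the first is at least [gabs * sigma]. *)
pose C2 := 1 + (Num.sqrt gsq)^-1 + c^-1.
pose C3 := 1 + Num.sqrt gsq / gabs.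
have C2_ge1 : 1 <= C2 by rewrite /C2 -addrA lerDl addr_ge0// invr_ge0 ltW.
have C3_ge1 : 1 <= C3 by rewrite lerDl divr_ge0 ?ltW.
exists (18 * C2 * C3); first by nra.
move=> d b s disp T P g d0 b0 bsym bsorted gP X Q1 Q2 Q3.
set K := explicit_bound b (permute_mx b s) in Q3 *.
set sigma := maxI (fun i => Num.sqrt (\sum_j b i j ^+ 2)).
have sigma0 : 0 <= sigma by exact: maxI_ge0.
pose S := maxI (fun i : 'I_d => maxI (fun j =>
  permute_mx b s i j * Num.sqrt (ln i.+1%:R))).
have S0 : 0 <= S by exact: maxI_ge0.
have KE : K = sigma + S by [].
have K0 : 0 <= K by rewrite KE addr_ge0.
(* [K] may vanish, while [expected_max_row_norm_le] requires a positive constant; hence the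
   perturbation by [e / 18]. *)
have Q1K : (Q1 <= (18 * K)%:E)%E.
  apply/lee_addgt0Pr => e e0.
  have K'K : K <= K + e / 18 by rewrite lerDl divr_ge0// ltW.
  have KK2 : K ^+ 2 <= (K + e / 18) ^+ 2.
    by rewrite ler_sqr ?nnegrE// (le_trans K0).
  rewrite -EFinD (_ : 18 * K + e = 18 * (K + e / 18)); last by field.
  apply: (expected_max_row_norm_le (s := s)) => //.
  - by rewrite ltr_pwDr// divr_gt0.
  - move=> i; apply: le_trans KK2.
    rewrite -[leLHS]sqr_sqrtr ?sum_sqr_ge0// ler_sqr ?nnegrE ?sqrtr_ge0//.
    apply: le_trans (maxI_ge (fun i => Num.sqrt (\sum_j b i j ^+ 2)) i) _.
    by rewrite KE lerDl.
  - move=> k j; apply: le_trans (explicit_bound_entry s k j b0) _.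
    by rewrite ler_pM2l.
have Q1_ge0 : (0 <= Q1)%E by apply: expectation_ge0 => w; exact: maxI_ge0.
set N := ('E_P[fun w => maxI (fun i => maxI (fun j => `|X w i j|%R))])%E.
have NQ1 : (N <= Q1)%E by exact: expected_max_entry_le.
have N_ge0 : (0 <= N)%E by apply: expectation_ge0 => w; exact: maxI_ge0.
have Q1_fin : Q1 \is a fin_num.
  by rewrite ge0_fin_numE// (le_lt_trans Q1K)// ltry.
have N_fin : N \is a fin_num.
  by rewrite ge0_fin_numE// (le_lt_trans NQ1)// (le_lt_trans Q1K)// ltry.
pose q := fine Q1; pose n := fine N.
have qE : Q1 = q%:E by rewrite fineK.
have nE : N = n%:E by rewrite fineK.
have n0 : 0 <= n by rewrite -lee_fin -nE.
have nq : n <= q by rewrite -lee_fin -nE -qE.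
have qK : q <= 18 * K by rewrite -lee_fin -qE.
have Q2E : Q2 = (Num.sqrt gsq * sigma + n)%:E.
  by rewrite /Q2 /norm_plus_expected_max sqrt_spectral_norm_expectation_mx_sqr// -/N nE.
have Sn : S <= c^-1 * n.
  apply: maxI_le => [|i]; first by rewrite mulr_ge0// invr_ge0 ltW.
  apply: maxI_le => [|j]; first by rewrite mulr_ge0// invr_ge0 ltW.
  rewrite ler_pdivlMl// -lee_fin -nE.
  exact: (expected_max_entry_ge b0 bsorted gP).
have sigmaq : sigma <= gabs^-1 * q.
  have q0 : 0 <= q by apply: le_trans nq.
  apply: maxI_le => [|i]; first by rewrite mulr_ge0// invr_ge0 ltW.
  rewrite ler_pdivlMl// -lee_fin -qE.
  exact: (row_norm_le_expectation b0 gP).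
set p := Num.sqrt gsq * sigma + n.
have p0 : 0 <= p by rewrite addr_ge0// mulr_ge0// ltW.
have KC2p : K <= C2 * p.
  have sp : sigma <= (Num.sqrt gsq)^-1 * p.
    by rewrite ler_pdivlMl// lerDl.
  have np : c^-1 * n <= c^-1 * p.
    by rewrite ler_wpM2l ?invr_ge0 ?(ltW c0)// lerDr mulr_ge0// ltW.
  rewrite KE /C2 !mulrDl mul1r; lra.
have pC3q : p <= C3 * q.
  have := ler_wpM2l (ltW sgsq0) sigmaq.
  rewrite /p /C3 mulrDl mul1r mulrA; lra.
have q0 : 0 <= q by apply: le_trans nq.
have C0 : 0 <= C2 by lra.
have C0' : 0 <= C3 by lra.
have C23 : C2 * p <= C2 * (C3 * q) by rewrite ler_wpM2l.
have C31 : C3 * q <= C3 * (18 * K) by rewrite ler_wpM2l.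
have C12 : 18 * K <= 18 * (C2 * p) by rewrite ler_wpM2l.
have C2_mul x : 0 <= x -> x <= C2 * x by move=> x0; rewrite ler_peMl.
have C3_mul x : 0 <= x -> x <= C3 * x by move=> x0; rewrite ler_peMl.
have K2_ge0 : 0 <= C2 * K by rewrite mulr_ge0.
have q3_ge0 : 0 <= C3 * q by rewrite mulr_ge0.
have p2_ge0 : 0 <= C2 * p by rewrite mulr_ge0.
have k3_ge0 : 0 <= C3 * K by rewrite mulr_ge0.
have CCq : C2 * (C3 * q) <= 18 * C2 * C3 * q.
  by rewrite -!mulrA ler_peMl ?mulr_ge0// ler1n.
rewrite Q2E -/p qE /Q3 /comparable_upto -!EFinM !lee_fin.
(* Each inequality follows an arc of the cycle [q <= 18 K <= 18 C2 p <= 18 C2 C3 q]; the remaining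
   constants are at least 1. *)
split; split.
- apply: le_trans qK _; apply: le_trans C12 _.
  by have := C3_mul _ p2_ge0; lra.
- apply: le_trans pC3q (le_trans _ CCq); exact: C2_mul.
- apply: le_trans qK _; have := C2_mul _ K0; have := C3_mul _ K2_ge0; lra.
- exact: le_trans KC2p (le_trans C23 CCq).
- apply: le_trans pC3q (le_trans C31 _); have := C2_mul _ k3_ge0; lra.
- apply: le_trans KC2p _; have := C3_mul _ p2_ge0; lra.
Qed.
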